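(* Let there be given $n$ triples $(\alpha_j,\beta_j,\kappa_j)$, $1\le j\le n$, such that $$\alpha_j'-\mu\alpha_j=\kappa_j\beta_j,\qquad \beta_j'+\mu\beta_j=\kappa_j\alpha_j .$$ Assume that $\alpha_1,\dots,\alpha_n$ are linearly independent, and that $\beta_1,\dots,\beta_n$ are also linearly independent. To each solution $(a,b,k)$ of the system $$a'-\mu a=-kb,\qquad b'+\mu b=ka$$ associate $$a_n=\frac{W(\alpha_1,\dots,\alpha_n,a)}{W(\alpha_1,\dots,\alpha_n)},\qquad b_n=\frac{W(\beta_1,\dots,\beta_n,b)}{W(\beta_1,\dots,\beta_n)}.$$ Then going from $(a,b)$ to $(a_n,b_n)$ is the result of the $n$ successive simultaneous Darboux transformations associated to $(\alpha_1,\beta_1),\dots,(\alpha_n,\beta_n)$ (themselves transformed along the way). Moreover $$a_n'-\mu_na_n=-kb_n,\qquad b_n'+\mu_nb_n=ka_n,$$ where $$\mu_n=\mu-\frac{d}{dx}\log\frac{W(\alpha_1,\dots,\alpha_n)}{W(\beta_1,\dots,\beta_n)}.$$ If furthermore $\tau$ is a function such that $\mu^2=-(\log\tau)''$, then $$\mu_n^2=-\frac{d^2}{dx^2}\log\tau_n,\qquad\text{where}\quad \tau_n=\tau\cdot W(\alpha_1,\dots,\alpha_n)\,W(\beta_1,\dots,\beta_n).$$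
   Context: Derivatives are with respect to a variable $x$; $\mu=\mu(x)$ is a given coefficient function, $k,\kappa_j\in\mathbb C$ are constants, and $a,b,\alpha_j,\beta_j$ are (complex valued) functions of $x$, sufficiently differentiable for the expressions to make sense; identities are understood where the denominators do not vanish. $\frac{d}{dx}\log f$ means $f'/f$. $W(f_1,\dots,f_m)=\det(f_j^{(i-1)})_{1\le i,j\le m}$ is the Wronskian determinant with respect to $x$. The simultaneous Darboux transformation associated to a couple $(\alpha,\beta)$ is the map $(a,b)\mapsto\left(a'-\frac{\alpha'}\alpha a,\ b'-\frac{\beta'}\beta b\right)$. The $n$ successive simultaneous Darboux transformations ''associated to $(\alpha_1,\beta_1),\dots,(\alpha_n,\beta_n)$, themselves transformed along the way'' means: first apply the transformation associated to $(\alpha_1,\beta_1)$ to $(a,b)$ and to all the couples $(\alpha_j,\beta_j)$, $j\ge2$; then apply to the results the transformation associated to the transformed couple $(\alpha_2^{(1)},\beta_2^{(1)})$; then the one associated to the twice transformed couple $(\alpha_3^{(2)},\beta_3^{(2)})$; and so on up to $(\alpha_n^{(n-1)},\beta_n^{(n-1)})$. *)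

(* Defs.v *)
From HB Require Import structures.
From mathcomp Require Import all_boot all_order all_algebra.
From mathcomp Require Import complex.
From mathcomp Require Import all_classical all_reals all_analysis.

Set Implicit Arguments.
Unset Strict Implicit.
Unset Printing Implicit Defensive.

Import Order.TTheory GRing.Theory Num.Theory.
Import numFieldNormedType.Exports.

Local Open Scope ring_scope.
Local Open Scope complex_scope.
Local Open Scope classical_set_scope.

Section ComplexValuedFunctions.
Variable R : realType.
Implicit Types (f g : R -> R[i]) (I : set R) (x : R).

(* The variable x is real and the values are complex. R[i] carries no normed
   R-module structure in the library, so differentiation is done on the real
   and imaginary parts. As for [derive1], [cderiv f x] is meaningful only where
   [cderivable f x] holds. *)
Definition cderivable f x : Prop :=
  derivable (fun t => complex.Re (f t)) x 1 /\
  derivable (fun t => complex.Im (f t)) x 1.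

Definition cderiv f : R -> R[i] := fun x =>
  (fun t => complex.Re (f t))^`() x +i* (fun t => complex.Im (f t))^`() x.

Definition cderivn (m : nat) f : R -> R[i] := iter m cderiv f.

Definition cderivable_upto I (m : nat) f : Prop :=
  forall (k : nat) x, (k < m)%N -> I x -> cderivable (cderivn k f) x.

(* (log f)' is to be read as f' / f. *)
Definition dlog f : R -> R[i] := fun x => cderiv f x / f x.

(* Families f_1, ..., f_m are the values at 0, ..., m - 1 of a sequence. *)
Definition wronskian (m : nat) (f : nat -> R -> R[i]) : R -> R[i] :=
  fun x => \det (\matrix_(i < m, j < m) cderivn i (f j) x).

(* The family f_1, ..., f_m, g. *)
Definition append (m : nat) (f : nat -> R -> R[i]) g : nat -> R -> R[i] :=
  fun j => if (j < m)%N then f j else g.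

Definition linearly_independent_on I (m : nat) (f : nat -> R -> R[i]) : Prop :=
  forall c : nat -> R[i],
    (forall x, I x -> \sum_(j < m) c j * f j x = 0) ->
    forall j, (j < m)%N -> c j = 0.

Definition couple : Type := ((R -> R[i]) * (R -> R[i]))%type.

(* [darboux c p] transforms p by the transformation associated to c. It is
   meaningful where neither component of c vanishes. *)
Definition darboux (c p : couple) : couple :=
  (fun x => cderiv p.1 x - cderiv c.1 x / c.1 x * p.1 x,
   fun x => cderiv p.2 x - cderiv c.2 x / c.2 x * p.2 x).

(* [darboux_iter c m p] is p^(m): the step from m to m + 1 uses the couple of
   index m, itself transformed m times. *)
Fixpoint darboux_iter (c : nat -> couple) (m : nat) (p : couple) : couple :=
  if m is m'.+1
  then darboux (darboux_iter c m' (c m')) (darboux_iter c m' p)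
  else p.

Definition darboux_defined_at (c : nat -> couple) (m : nat) x : Prop :=
  forall j, (j < m)%N ->
    (darboux_iter c j (c j)).1 x != 0 /\ (darboux_iter c j (c j)).2 x != 0.

End ComplexValuedFunctions.

(* Main.v *)
Require Import Defs.
From HB Require Import structures.
From mathcomp Require Import all_boot all_order all_algebra.
From mathcomp Require Import perm ring.
From mathcomp Require Import complex.
From mathcomp Require Import all_classical all_reals all_analysis.

Set Implicit Arguments.
Unset Strict Implicit.
Unset Printing Implicit Defensive.

Import Order.TTheory GRing.Theory Num.Theory.
Import numFieldNormedType.Exports.

Local Open Scope ring_scope.
Local Open Scope complex_scope.
Local Open Scope classical_set_scope.

(** Let [A] and [B] be the Wronskian matrices of the two families, and let
    [P = A' A^-1] and [Q = B' B^-1]. By Jacobi's formula the traces of [P] and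
    [Q] are the logarithmic derivatives of the Wronskians
    ([has_cderiv_wronskian]). The matrices [P] and [Q] are companion matrices,
    hence they differ on their last row only, and for every function [f] the jet
    [v = (f, f', ..., f^(n-1))] satisfies
    [v' = P v + (W(alpha_1, ..., alpha_n, f) / W(alpha_1, ..., alpha_n)) e],
    where [e] is the last basis vector ([jet1E]). So [a_n] measures how far the
    jet of [a] is from being constant for the covariant derivative [d/dx - P].

    Let [M] be the lower triangular matrix of multiplication by [mu] on jets
    (Leibniz rule), with [mu] on the diagonal, and [G = P - M]. The equations of
    the seeds, differentiated up to [n - 1] times, say that [G A = B K] with [K]
    constant and diagonal. Differentiating this equality gives the intertwining
    relation [G' + G P = Q G] ([intertwining]). Applied to the jets of [a] and
    [b] it leaves, on the last coordinate, the equation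
    [a_n' - (mu - d) a_n = -k b_n] with [d = \tr P - \tr Q]
    ([seed_equation]), and [mu - d] is [mu_n]. Exchanging the two families and
    changing the signs of [mu] and [k] gives the equation for [b_n]. This
    argument takes place at points where the two full Wronskians are nonzero;
    the Wronskians of the subfamilies may vanish there.

    For the tau function, let [H] play for the exchanged families the role of
    [G]. The sum of the traces of the two intertwining relations is
    [\tr P' + \tr Q' = \tr ((P - Q) (H - G)) = d (2 mu - d)], which is
    [mu^2 - mu_n^2] ([seed_trace]). The left-hand side is the second logarithmic
    derivative of the product of the Wronskians: multiplying [tau] by this
    product changes minus its second logarithmic derivative from [mu^2] to
    [mu_n^2] ([seed_tau]).

    Finally, [n] successive Darboux transformations compose to a monic
    differential operator of order [n] that annihilates the seeds
    ([darboux1_operator], [darboux1_kernel]), and such an operator is the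
    quotient of Wronskians, by row operations on the bordered Wronskian matrix
    ([wronskian_append]). *)

(** * Derivatives of complex-valued functions *)

Section ComplexDerivative.
Variable R : realType.
Implicit Types (f g : R -> R[i]) (x : R) (k l : R[i]).

(** A relational derivative: the rules below then compute the value of a
    derivative together with its existence. *)
Definition has_cderiv f x l : Prop :=
  is_derive x 1 (fun t => complex.Re (f t)) (complex.Re l) /\
  is_derive x 1 (fun t => complex.Im (f t)) (complex.Im l).

Lemma cderivableP f x : cderivable f x -> has_cderiv f x (cderiv f x).
Proof.
by case=> dr di; split; rewrite /cderiv /= derive1E; exact: derivableP.
Qed.

Lemma has_cderivE f x l : has_cderiv f x l -> cderiv f x = l.
Proof.
case=> dr di; rewrite /cderiv !derive1E.
rewrite (@derive_val _ _ _ _ _ _ _ dr) (@derive_val _ _ _ _ _ _ _ di).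
by case: l {dr di}.
Qed.

Lemma has_cderiv_cderivable f x l : has_cderiv f x l -> cderivable f x.
Proof. by case=> [[dr _] [di _]]. Qed.

Lemma near_has_cderiv f g x l : (\forall t \near x, f t = g t) ->
  has_cderiv f x l -> has_cderiv g x l.
Proof.
move=> fg [dr di]; split.
  by apply: near_eq_is_derive dr; apply: filterS fg => t ->.
by apply: near_eq_is_derive di; apply: filterS fg => t ->.
Qed.

Lemma has_cderiv_eq f x k l : has_cderiv f x k -> k = l -> has_cderiv f x l.
Proof. by move=> ? <-. Qed.

Lemma has_cderiv_cst k x : has_cderiv (fun=> k) x 0.
Proof. by split; exact: is_derive_cst. Qed.

Lemma ReD k l : complex.Re (k + l) = complex.Re k + complex.Re l.
Proof. by case: k l => [? ?] []. Qed.

Lemma ImD k l : complex.Im (k + l) = complex.Im k + complex.Im l.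
Proof. by case: k l => [? ?] []. Qed.

Lemma has_cderivD f g x k l : has_cderiv f x k -> has_cderiv g x l ->
  has_cderiv (fun t => f t + g t) x (k + l).
Proof.
move=> [fr fi] [gr gi]; split.
  by rewrite ReD; under eq_fun do rewrite ReD; exact: is_deriveD.
by rewrite ImD; under eq_fun do rewrite ImD; exact: is_deriveD.
Qed.

Lemma ReM k l : complex.Re (k * l) =
  complex.Re k * complex.Re l - complex.Im k * complex.Im l.
Proof. by case: k l => [? ?] []. Qed.

Lemma ImM k l : complex.Im (k * l) =
  complex.Re k * complex.Im l + complex.Im k * complex.Re l.
Proof. by case: k l => [? ?] []. Qed.

Lemma has_cderivM f g x k l : has_cderiv f x k -> has_cderiv g x l ->
  has_cderiv (fun t => f t * g t) x (k * g x + f x * l).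
Proof.
move=> [fr fi] [gr gi]; split.
  under eq_fun do rewrite ReM.
  apply: (is_derive_eq (is_deriveB (is_deriveM fr gr) (is_deriveM fi gi))).
  by rewrite /GRing.scale/= ReD !ReM; ring.
under eq_fun do rewrite ImM.
apply: (is_derive_eq (is_deriveD (is_deriveM fr gi) (is_deriveM fi gr))).
by rewrite /GRing.scale/= ImD !ImM; ring.
Qed.

Lemma has_cderivZ f x k l : has_cderiv f x l ->
  has_cderiv (fun t => k * f t) x (k * l).
Proof.
move=> df; apply: has_cderiv_eq (has_cderivM (has_cderiv_cst k x) df) _.
by rewrite mul0r add0r.
Qed.

Lemma has_cderivN f x k : has_cderiv f x k ->
  has_cderiv (fun t => - f t) x (- k).
Proof.
move=> df; rewrite -mulN1r; under [X in has_cderiv X]eq_fun do rewrite -mulN1r.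
exact: has_cderivZ.
Qed.

Lemma has_cderivB f g x k l : has_cderiv f x k -> has_cderiv g x l ->
  has_cderiv (fun t => f t - g t) x (k - l).
Proof. by move=> df dg; apply: has_cderivD df (has_cderivN dg). Qed.

Lemma cderivable_near_neq0 f x : cderivable f x -> f x != 0 ->
  \forall t \near x, f t != 0.
Proof.
move=> [/derivable1_diffP/differentiable_continuous cr].
move=> /derivable1_diffP/differentiable_continuous ci.
have opn : open [set y : R | y != 0] by exact: open_neq.
have neqE (z : R[i]) : (z != 0) = (complex.Re z != 0) || (complex.Im z != 0).
  by rewrite eq_complex negb_and.
rewrite neqE => /orP[h|h].
  have : \forall t \near x, complex.Re (f t) != 0.
    by apply: (cr [set y | y != 0]); exact: open_nbhs_nbhs.
  by apply: filterS => t; rewrite neqE => ->.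
have : \forall t \near x, complex.Im (f t) != 0.
  by apply: (ci [set y | y != 0]); exact: open_nbhs_nbhs.
by apply: filterS => t; rewrite neqE => ->; rewrite orbT.
Qed.

(** Differentiability of the inverse is read off from its real and imaginary
    parts; the value then follows by differentiating [f * f^-1 = 1]. *)
Lemma has_cderivV f x k : f x != 0 -> has_cderiv f x k ->
  has_cderiv (fun t => (f t)^-1) x (- k / (f x * f x)).
Proof.
move=> fx0 df.
have fx : complex.Re (f x) ^+ 2 + complex.Im (f x) ^+ 2 != 0.
  apply: contraNneq fx0 => /eqP.
  by rewrite paddr_eq0 ?sqr_ge0// !sqrf_eq0 eq_complex.
have ReV (l : R[i]) : complex.Re l^-1 =
    complex.Re l * (complex.Re l ^+ 2 + complex.Im l ^+ 2)^-1 by case: l.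
have ImV (l : R[i]) : complex.Im l^-1 =
    - complex.Im l * (complex.Re l ^+ 2 + complex.Im l ^+ 2)^-1.
  by case: l => ? ?; rewrite mulNr.
have [dr di] := has_cderiv_cderivable df.
have dn : derivable (fun t =>
    (complex.Re (f t) ^+ 2 + complex.Im (f t) ^+ 2)^-1) x 1.
  apply: (@derivableV _ _ (fun t =>
    complex.Re (f t) ^+ 2 + complex.Im (f t) ^+ 2) x 1 fx).
  under eq_fun do rewrite !expr2.
  exact: (derivableD (derivableM dr dr) (derivableM di di)).
have dV : cderivable (fun t => (f t)^-1) x.
  split.
    by under eq_fun do rewrite ReV; exact: (derivableM dr dn).
  by under eq_fun do rewrite ImV; exact: (derivableM (derivableN di) dn).
apply: (has_cderiv_eq (cderivableP dV)).
have := has_cderivM df (cderivableP dV).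
have d1 : has_cderiv (fun t => f t * (f t)^-1) x 0.
  apply: near_has_cderiv (has_cderiv_cst 1 x).
  have := cderivable_near_neq0 (conj dr di) fx0.
  by apply: filterS => t ft; rewrite divff.
move=> /has_cderivE; rewrite (has_cderivE d1) => /esym/eqP.
rewrite addrC addr_eq0 => /eqP h.
apply: (mulfI fx0); rewrite h; field; exact: fx0.
Qed.

Lemma has_cderiv_sum (J : Type) (r : seq J) (f : J -> R -> R[i]) x
    (k : J -> R[i]) :
  (forall j, has_cderiv (f j) x (k j)) ->
  has_cderiv (fun t => \sum_(j <- r) f j t) x (\sum_(j <- r) k j).
Proof.
move=> df; elim: r => [|j r IH].
  by under eq_fun do rewrite big_nil; rewrite big_nil; exact: has_cderiv_cst.
under eq_fun do rewrite big_cons.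
by rewrite big_cons; exact: has_cderivD.
Qed.

(** The Leibniz rule in the shape required by determinants: each summand is
    the product in which a single factor has been replaced by its
    derivative. *)
Lemma has_cderiv_prod (J : eqType) (r : seq J) (f : J -> R -> R[i]) x
    (k : J -> R[i]) :
  uniq r -> (forall j, has_cderiv (f j) x (k j)) ->
  has_cderiv (fun t => \prod_(j <- r) f j t) x
    (\sum_(i <- r) \prod_(j <- r) (if j == i then k j else f j x)).
Proof.
move=> + df; elim: r => [_|j r IH /= /andP[jr /IH dr]].
  by under eq_fun do rewrite big_nil; rewrite big_nil; exact: has_cderiv_cst.
under eq_fun do rewrite big_cons.
apply: has_cderiv_eq (has_cderivM (df j) dr) _.
rewrite big_cons big_cons eqxx; congr (_ * _ + _).
  apply: eq_big_seq => i ir; case: eqP => // ij; by rewrite -ij ir in jr.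
rewrite big_distrr /=; apply: eq_big_seq => i ir; rewrite big_cons.
by case: eqP => // ij; rewrite ij ir in jr.
Qed.

Lemma has_cderiv_sum_mul n (p q : 'I_n -> R -> R[i]) x (p' q' : 'I_n -> R[i]) :
  (forall i, has_cderiv (p i) x (p' i)) ->
  (forall i, has_cderiv (q i) x (q' i)) ->
  has_cderiv (fun t => \sum_i p i t * q i t) x
    (\sum_i p' i * q i x + \sum_i p i x * q' i).
Proof.
move=> dp dq; rewrite -big_split /=; apply: has_cderiv_sum => i.
exact: has_cderivM.
Qed.

End ComplexDerivative.

(** * Iterated derivatives and the Leibniz rule *)

Section IteratedDerivative.
Variable R : realType.
Implicit Types (f g : R -> R[i]) (U V : set R) (x : R) (k : R[i]) (m : nat).

Lemma cderivnS m f : cderivn m.+1 f = cderiv (cderivn m f).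
Proof. by []. Qed.

Lemma cderivn_add m p f : cderivn m (cderivn p f) = cderivn (m + p) f.
Proof. by rewrite /cderivn iterD. Qed.

Lemma has_cderiv_cderivn U m f x i : cderivable_upto U m f -> (i < m)%N ->
  U x -> has_cderiv (cderivn i f) x (cderivn i.+1 f x).
Proof. by move=> fU im Ux; apply: cderivableP; exact: fU. Qed.

Lemma open_near U f g x : open U -> U x -> (forall t, U t -> f t = g t) ->
  \forall t \near x, f t = g t.
Proof. by move=> oU Ux fg; apply: filterS (open_nbhs_nbhs (conj oU Ux)). Qed.

Lemma open_has_cderiv U f g x l : open U -> U x ->
  (forall t, U t -> f t = g t) -> has_cderiv f x l -> has_cderiv g x l.
Proof. by move=> oU Ux fg; apply: near_has_cderiv; exact: open_near fg. Qed.

Lemma cderivable_uptoW U m p f : (m <= p)%N -> cderivable_upto U p f ->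
  cderivable_upto U m f.
Proof. by move=> mp fU i x im; apply: fU; exact: leq_trans mp. Qed.

Lemma cderivable_upto_sub U V m f : U `<=` V -> cderivable_upto V m f ->
  cderivable_upto U m f.
Proof. by move=> UV fV i x im /UV; exact: fV. Qed.

Lemma cderivable_upto_cderivn U m p f : cderivable_upto U (m + p) f ->
  cderivable_upto U m (cderivn p f).
Proof.
by move=> fU i x im Ux; rewrite cderivn_add; apply: fU; rewrite ?ltn_add2r.
Qed.

(** Differentiation is local: on an open set, functions that agree there may
    be exchanged, whatever they do elsewhere. *)
Lemma eq_cderivn U i f g x : open U -> (forall t, U t -> f t = g t) ->
  U x -> cderivn i f x = cderivn i g x.
Proof.
move=> oU fg; elim: i x => [|i IH] x Ux; first exact: fg.
rewrite /= /cderiv !derive1E.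
by congr (_ +i* _); apply: near_eq_derive;
  apply: filterS (open_nbhs_nbhs (conj oU Ux)) => t Ut; rewrite IH.
Qed.

Lemma eq_cderivable U f g x : open U -> (forall t, U t -> f t = g t) ->
  U x -> cderivable f x -> cderivable g x.
Proof.
move=> oU fg Ux /cderivableP df; apply: has_cderiv_cderivable.
exact: open_has_cderiv oU Ux fg df.
Qed.

Lemma eq_cderivable_upto U m f g : open U -> (forall t, U t -> f t = g t) ->
  cderivable_upto U m f -> cderivable_upto U m g.
Proof.
move=> oU fg fU i x im Ux; apply: (@eq_cderivable U (cderivn i f)) => //.
- by move=> t Ut; exact: eq_cderivn Ut.
- exact: fU.
Qed.

(** The induction principle behind the closure properties of
    [cderivable_upto]: any function that is the derivative of [f] on [U] may
    stand for [cderiv f]. *)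
Lemma cderivable_uptoS U m f g : open U ->
  (forall x, U x -> has_cderiv f x (g x)) ->
  cderivable_upto U m g -> cderivable_upto U m.+1 f.
Proof.
move=> oU fg gU [|i] x im Ux; first exact: has_cderiv_cderivable (fg x Ux).
rewrite /cderivn iterSr -/(cderivn i (cderiv f)).
apply: (@eq_cderivable U (cderivn i g)) => //; last exact: gU.
move=> t Ut; apply: (@eq_cderivn U) => // s Us.
by apply/esym/has_cderivE/fg.
Qed.

Lemma cderivable_uptoP U m f x i : cderivable_upto U m f -> (i < m)%N ->
  U x -> cderivable (cderivn i f) x.
Proof. exact. Qed.

Lemma cderivable_upto0 U f : cderivable_upto U 0 f.
Proof. by []. Qed.

Lemma cderivable_upto_cst U m k : cderivable_upto U m (fun=> k).
Proof.
have E i : cderivn i (fun=> k) = (fun=> if i is 0 then k else 0) :> (R -> R[i]).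
  elim: i => // i IH; rewrite cderivnS IH; apply/funext => t.
  exact/has_cderivE/has_cderiv_cst.
move=> i x _ _; rewrite E; apply: has_cderiv_cderivable.
exact: has_cderiv_cst.
Qed.

End IteratedDerivative.

(* From here on, derivatives are handled through the rules above only. *)
#[local] Opaque cderivable_upto has_cderiv cderiv.

Section CderivableUpto.
Variable R : realType.
Implicit Types (f g : R -> R[i]) (U V : set R) (x : R) (k : R[i]) (m : nat).

Lemma cderivable_uptoD U m f g : open U -> cderivable_upto U m f ->
  cderivable_upto U m g -> cderivable_upto U m (fun t => f t + g t).
Proof.
move=> oU; elim: m f g => [|m IH] f g.
  by move=> *; exact: cderivable_upto0.
move=> fU gU.
apply: (@cderivable_uptoS _ U m _ (fun t => cderiv f t + cderiv g t) oU).
  move=> x Ux; apply: has_cderivD; apply: cderivableP.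
    exact: (cderivable_uptoP (i := 0) fU).
  exact: (cderivable_uptoP (i := 0) gU).
by apply: IH; apply: (@cderivable_upto_cderivn _ U m 1); rewrite addn1.
Qed.

Lemma cderivable_uptoM U m f g : open U -> cderivable_upto U m f ->
  cderivable_upto U m g -> cderivable_upto U m (fun t => f t * g t).
Proof.
move=> oU; elim: m f g => [|m IH] f g.
  by move=> *; exact: cderivable_upto0.
move=> fU gU.
apply: (@cderivable_uptoS _ U m _
  (fun t => cderiv f t * g t + f t * cderiv g t) oU).
  move=> x Ux; apply: has_cderivM; apply: cderivableP.
    exact: (cderivable_uptoP (i := 0) fU).
  exact: (cderivable_uptoP (i := 0) gU).
have fm := cderivable_uptoW (leqnSn m) fU.
have gm := cderivable_uptoW (leqnSn m) gU.
have fm' : cderivable_upto U m (cderiv f).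
  by apply: (@cderivable_upto_cderivn _ U m 1); rewrite addn1.
have gm' : cderivable_upto U m (cderiv g).
  by apply: (@cderivable_upto_cderivn _ U m 1); rewrite addn1.
exact: (cderivable_uptoD oU (IH _ _ fm' gm) (IH _ _ fm gm')).
Qed.

Lemma cderivable_uptoZ U m k f : open U -> cderivable_upto U m f ->
  cderivable_upto U m (fun t => k * f t).
Proof.
by move=> oU; apply: (cderivable_uptoM oU); exact: cderivable_upto_cst.
Qed.

Lemma cderivable_uptoB U m f g : open U -> cderivable_upto U m f ->
  cderivable_upto U m g -> cderivable_upto U m (fun t => f t - g t).
Proof.
move=> oU fU gU; apply: (cderivable_uptoD oU fU).
under [X in cderivable_upto _ _ X]eq_fun do rewrite -mulN1r.
exact: (cderivable_uptoZ _ oU gU).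
Qed.

Lemma cderivable_uptoV U m f : open U -> (forall t, U t -> f t != 0) ->
  cderivable_upto U m f -> cderivable_upto U m (fun t => (f t)^-1).
Proof.
move=> oU f0; elim: m => [|m IH] fU; first exact: cderivable_upto0.
have fV := IH (cderivable_uptoW (leqnSn m) fU).
apply: (@cderivable_uptoS _ U m _
  (fun t => -1 * (cderiv f t * ((f t)^-1 * (f t)^-1))) oU).
  move=> x Ux; have df := cderivableP (cderivable_uptoP (i := 0) fU isT Ux).
  apply: has_cderiv_eq (has_cderivV (f0 x Ux) df) _.
  by rewrite invfM mulN1r mulNr.
apply: (cderivable_uptoZ _ oU); apply: (cderivable_uptoM oU).
  by apply: (@cderivable_upto_cderivn _ U m 1); rewrite addn1.
exact: (cderivable_uptoM oU fV fV).
Qed.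

Lemma open_setI_neq0 U f : open U -> (forall x, U x -> cderivable f x) ->
  open (U `&` [set x | f x != 0]).
Proof.
move=> oU fU; rewrite openE => x [Ux fx]; apply: filterI.
  exact: open_nbhs_nbhs.
by apply: cderivable_near_neq0 => //; exact: fU.
Qed.

(** The coefficient of [g^(l)] in [(f g)^(i)]. It is [0] for [l > i], where
    [i - l] is truncated, so sums may range over any [l < n] with [i < n]. *)
Definition leibniz_coef f i (l : nat) : R -> R[i] :=
  fun x => 'C(i, l)%:R * cderivn (i - l) f x.

Lemma cderivn_mul U n f g i x : open U -> cderivable_upto U i f ->
  cderivable_upto U i g -> (i < n)%N -> U x ->
  cderivn i (fun t => f t * g t) x =
  \sum_(l < n) leibniz_coef f i l x * cderivn l g x.
Proof.
move=> oU + + + ; elim: i x => [|i IH] x fU gU iN Ux.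
  case: n iN => // n _; rewrite big_ord_recl big1 => [|j _].
    by rewrite /leibniz_coef bin0 mul1r addr0.
  by rewrite /leibniz_coef bin_small// !mul0r.
have fi := cderivable_uptoW (leqnSn i) fU.
have gi := cderivable_uptoW (leqnSn i) gU.
rewrite cderivnS; apply: has_cderivE.
apply: (@open_has_cderiv _ _ (fun t =>
  \sum_(l < n) leibniz_coef f i l t * cderivn l g t) _ _ _ oU Ux).
  by move=> t Ut; rewrite (IH t fi gi (ltnW iN) Ut).
(* For [i < l] the function [cderivn l g] may fail to be differentiable, but
   then the binomial coefficient vanishes. *)
pose c l := 'C(i, l)%:R : R[i].
have dterm (l : nat) : has_cderiv
    (fun t => leibniz_coef f i l t * cderivn l g t) x
    (c l * (cderivn (i - l).+1 f x * cderivn l g x) +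
     c l * (cderivn (i - l) f x * cderivn l.+1 g x)).
  rewrite /leibniz_coef; have [il|li] := ltnP i l.
    rewrite /c bin_small// !mul0r addr0.
    by under [X in has_cderiv X]eq_fun do rewrite !mul0r; exact: has_cderiv_cst.
  under [X in has_cderiv X]eq_fun do rewrite -mulrA.
  rewrite -mulrDr; apply/has_cderivZ/has_cderivM.
    by apply: (has_cderiv_cderivn fU _ Ux); rewrite ltnS leq_subr.
  exact: (has_cderiv_cderivn gU _ Ux).
apply: has_cderiv_eq (has_cderiv_sum _ (fun l : 'I_n => dterm l)) _.
rewrite big_split /=; case: n iN {IH} => // n iN.
rewrite big_ord_recl [X in _ + X]big_ord_recr /=.
rewrite [RHS]big_ord_recl /= /c bin0 subn0 (bin_small (n := i))//.
rewrite mul0r addr0 /leibniz_coef bin0 -addrA mulrA subn0; congr (_ + _).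
rewrite -big_split; apply: eq_bigr => l _; rewrite /= /bump /= add1n subSS.
rewrite binS natrD mulrDl mulrDl -!mulrA; congr (_ + _).
have [il|li] := ltnP i l.+1; first by rewrite bin_small// !mul0r.
by rewrite -(subnSK li).
Qed.

End CderivableUpto.

(** * Matrix-valued functions and intertwining relations *)

Section MatrixDerivative.
Variable R : realType.
Local Notation C := R[i].
Implicit Types x : R.

Definition has_mxderiv m n (F : R -> 'M[C]_(m, n)) x (F' : 'M[C]_(m, n)) :=
  forall i j, has_cderiv (fun t => F t i j) x (F' i j).

Lemma has_mxderiv_unique m n (F : R -> 'M[C]_(m, n)) x F1 F2 :
  has_mxderiv F x F1 -> has_mxderiv F x F2 -> F1 = F2.
Proof.
move=> d1 d2; apply/matrixP => i j.
by rewrite -(has_cderivE (d1 i j)) (has_cderivE (d2 i j)).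
Qed.

Lemma near_has_mxderiv m n (F G : R -> 'M[C]_(m, n)) x F' :
  (\forall t \near x, F t = G t) -> has_mxderiv F x F' -> has_mxderiv G x F'.
Proof.
move=> FG dF i j; apply: near_has_cderiv (dF i j).
by apply: filterS FG => t ->.
Qed.

Lemma has_mxderivD m n (F G : R -> 'M[C]_(m, n)) x F' G' :
  has_mxderiv F x F' -> has_mxderiv G x G' ->
  has_mxderiv (fun t => F t + G t) x (F' + G').
Proof.
move=> dF dG i j; rewrite mxE; under eq_fun do rewrite mxE.
exact: has_cderivD.
Qed.

Lemma has_mxderivB m n (F G : R -> 'M[C]_(m, n)) x F' G' :
  has_mxderiv F x F' -> has_mxderiv G x G' ->
  has_mxderiv (fun t => F t - G t) x (F' - G').
Proof.
move=> dF dG i j; rewrite !mxE; under eq_fun do rewrite !mxE.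
exact: has_cderivB.
Qed.

Lemma has_mxderivM m n p (F : R -> 'M[C]_(m, n)) (G : R -> 'M[C]_(n, p))
    x F' G' : has_mxderiv F x F' -> has_mxderiv G x G' ->
  has_mxderiv (fun t => F t *m G t) x (F' *m G x + F x *m G').
Proof.
move=> dF dG i j; rewrite !mxE; under eq_fun do rewrite mxE.
by apply: has_cderiv_sum_mul => l; [exact: dF | exact: dG].
Qed.

Lemma has_mxderivMr m n p (F : R -> 'M[C]_(m, n)) (K : 'M[C]_(n, p)) x F' :
  has_mxderiv F x F' -> has_mxderiv (fun t => F t *m K) x (F' *m K).
Proof.
move=> dF; rewrite -[X in has_mxderiv _ _ X]addr0 -(mulmx0 _ (F x)).
by apply: has_mxderivM => // i j; rewrite mxE; exact: has_cderiv_cst.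
Qed.

Lemma has_mxderivZl m n (f : R -> C) x l (K : 'M[C]_(m, n)) :
  has_cderiv f x l -> has_mxderiv (fun t => f t *: K) x (l *: K).
Proof.
move=> df i j; rewrite mxE; under eq_fun do rewrite mxE mulrC.
by rewrite mulrC; exact: has_cderivZ.
Qed.

Lemma has_mxderivZr m n k (F : R -> 'M[C]_(m, n)) x F' :
  has_mxderiv F x F' -> has_mxderiv (fun t => k *: F t) x (k *: F').
Proof.
move=> dF i j; rewrite mxE; under eq_fun do rewrite mxE.
exact: has_cderivZ.
Qed.

Lemma has_cderiv_mxtrace n (F : R -> 'M[C]_n) x F' :
  has_mxderiv F x F' -> has_cderiv (fun t => \tr (F t)) x (\tr F').
Proof. by move=> dF; apply: has_cderiv_sum => i; exact: dF. Qed.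

(** Jacobi's formula. Differentiating one row at a time gives determinants
    that are expanded along the row that has been differentiated. *)
Lemma has_cderiv_det n (A : R -> 'M[C]_n) x A' : has_mxderiv A x A' ->
  has_cderiv (fun t => \det (A t)) x (\tr (A' *m \adj (A x))).
Proof.
move=> dA; pose B i := \matrix_(k, l) (if k == i then A' k l else A x k l).
have dprod (s : 'S_n) : has_cderiv (fun t => \prod_i A t i (s i)) x
    (\sum_i \prod_j B i j (s j)).
  have := has_cderiv_prod (enum_uniq 'I_n) (fun i => dA i (s i)).
  rewrite big_enum /=; under eq_bigr => i _ do rewrite big_enum.
  under [X in has_cderiv X _ _ -> _]eq_fun do rewrite big_enum.
  by under [in X in _ -> X]eq_bigr => i _ do
    under eq_bigr => j _ do rewrite mxE.
rewrite /determinant.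
apply: has_cderiv_eq (has_cderiv_sum _ (fun s => has_cderivZ _ (dprod s))) _.
under eq_bigr do rewrite big_distrr.
rewrite exchange_big /=; apply: eq_bigr => i _.
rewrite -[LHS]/(\det (B i)) (expand_det_row _ i) mxE; apply: eq_bigr => j _.
rewrite !mxE eqxx; congr (_ * (_ * \det _)).
by apply/matrixP => k l; rewrite !mxE eq_sym (negPf (neq_lift _ _)).
Qed.

(** The formula with the adjugate reduces this to cofactors, which are
    determinants. *)
Lemma has_mxderiv_invmx n (A : R -> 'M[C]_n) x A' : has_mxderiv A x A' ->
  A x \in unitmx -> exists B', has_mxderiv (fun t => invmx (A t)) x B'.
Proof.
move=> dA uA; have dd := has_cderiv_det dA.
have d0 : \det (A x) != 0 by rewrite -unitfE -unitmxE.
have cof i j : exists l, has_cderiv (fun t => cofactor (A t) i j) x l.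
  have dm : has_mxderiv (fun t => row' i (col' j (A t))) x (row' i (col' j A')).
    by move=> k l; rewrite !mxE; under eq_fun do rewrite !mxE; exact: dA.
  by eexists; exact: (has_cderivZ _ (has_cderiv_det dm)).
have dV i j : exists l,
    has_cderiv (fun t => (\det (A t))^-1 * cofactor (A t) i j) x l.
  have [l dl] := cof i j; eexists; apply: has_cderivM dl.
  exact: has_cderivV dd.
pose B' := \matrix_(i, j) projT1 (cid (dV j i)).
exists B'.
apply: (@near_has_mxderiv _ _ (fun t => (\det (A t))^-1 *: \adj (A t))).
  have := cderivable_near_neq0 (has_cderiv_cderivable dd) d0.
  by apply: filterS => t dt; rewrite /invmx unitmxE unitfE dt.
move=> i j; under eq_fun do rewrite !mxE.
by rewrite mxE; case: cid.
Qed.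

End MatrixDerivative.

Section Intertwining.
Variables (R : realType) (n : nat).
Local Notation C := R[i].
Variables (x : R) (A B P Q G : R -> 'M[C]_n) (K G' : 'M[C]_n).
Hypothesis A_unit : A x \in unitmx.
Hypothesis dA : has_mxderiv A x (P x *m A x).
Hypothesis dB : has_mxderiv B x (Q x *m B x).
Hypothesis dG : has_mxderiv G x G'.
Hypothesis GA : \forall t \near x, G t *m A t = B t *m K.

(** If [A' = P A], [B' = Q B] and [G A = B K] with [K] constant, then [G]
    intertwines the covariant derivatives, [(d/dx - Q) G = G (d/dx - P)]:
    differentiate [G A = B K] and cancel the invertible [A]. *)
Lemma intertwining : G' + G x *m P x = Q x *m G x.
Proof.
have := near_has_mxderiv GA (has_mxderivM dG dA).
move/has_mxderiv_unique => /(_ _ (has_mxderivMr K dB)).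
rewrite -mulmxA -(nbhs_singleton GA) !mulmxA -mulmxDl => h.
by rewrite -(mulmxK A_unit (Q x *m _)) -h mulmxK.
Qed.

(** The same relation applied to vectors which are covariantly constant only
    up to a multiple of [e]: the terms in [v] cancel and only those in [e]
    are left. *)
Lemma intertwining_defect (v w : R -> 'cV[C]_n) (e : 'cV[C]_n) (k b a' : C)
    (a : R -> C) :
  has_mxderiv v x (P x *m v x + a x *: e) ->
  has_mxderiv w x (Q x *m w x + b *: e) ->
  has_cderiv a x a' ->
  (\forall t \near x, G t *m v t + a t *: e = k *: w t) ->
  (k * b) *: e = a' *: e + a x *: ((G x - Q x) *m e).
Proof.
move=> dv dw da Gv.
have := near_has_mxderiv Gv (has_mxderivD (has_mxderivM dG dv)
  (has_mxderivZl e da)).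
move/has_mxderiv_unique => /(_ _ (has_mxderivZr k dw)).
rewrite scalerDr scalerA scalemxAr -(nbhs_singleton Gv) !mulmxDr.
rewrite !mulmxA -!scalemxAr !addrA -mulmxDl intertwining => h.
apply: (addrI (Q x *m G x *m v x + a x *: (Q x *m e))).
rewrite -h mulmxBl scalerBr -!addrA; congr (_ + _).
by rewrite [RHS]addrCA subrKC addrC.
Qed.

End Intertwining.

(** If [D] lives on the last row and the last column of [X] is a multiple of
    the last basis vector, only one term of the trace survives. *)
Lemma mxtrace_mul_last_row (F : fieldType) n (D X : 'M[F]_n.+1) :
  (forall i j, i != ord_max -> D i j = 0) ->
  (forall i, i != ord_max -> X i ord_max = 0) ->
  \tr (D *m X) = \tr D * X ord_max ord_max.
Proof.
move=> D0 X0; have trD : \tr D = D ord_max ord_max.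
  by rewrite /mxtrace (bigD1 ord_max)//= big1 ?addr0// => i /D0.
rewrite trD /mxtrace (bigD1 ord_max)//= [X in _ + X]big1 => [|i i0]; last first.
  by rewrite mxE big1 // => j _; rewrite D0 ?mul0r.
rewrite addr0 mxE (bigD1 ord_max)//= [X in _ + X]big1 ?addr0// => j j0.
by rewrite X0 ?mulr0.
Qed.

(** * Wronskians and iterated Darboux transformations *)

Section Wronskian.
Variable R : realType.
Local Notation C := R[i].
Implicit Types (h : nat -> R -> C) (f : R -> C) (U I : set R) (x : R).
Implicit Types m N : nat.

(** A monic differential operator of order [m] that annihilates
    [h 0], ..., [h m.-1] at [x] sends [f] to the quotient of Wronskians.
    Subtracting from the last row of the bordered Wronskian matrix the
    combination of the others given by [c] leaves, on that row, only the value
    of the operator on [f]. The product form gives the next Wronskian even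
    before the previous one is known to be nonzero. *)
Lemma wronskian_append m h f x (c : 'I_m -> C) :
  (forall j, (j < m)%N ->
     cderivn m (h j) x = \sum_i c i * cderivn i (h j) x) ->
  wronskian m.+1 (append m h f) x =
  wronskian m h x * (cderivn m f x - \sum_i c i * cderivn i f x).
Proof.
move=> hm; rewrite /wronskian.
have -> : \det (\matrix_(i < m.+1, j < m.+1) cderivn i (append m h f j) x) =
    \det (\matrix_(i < m + 1, j < m + 1) cderivn i (append m h f j) x).
  by rewrite addn1.
pose W := \matrix_(i < m, j < m) cderivn i (h j) x.
pose v := \col_(i < m) cderivn i f x.
pose r := \row_(j < m) cderivn m (h j) x.
pose q := \row_(i < m) c i.
have -> : \matrix_(i < m + 1, j < m + 1) cderivn i (append m h f j) x =
    block_mx W v r (cderivn m f x)%:M.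
  apply/matrixP => i j; rewrite mxE /append.
  by case: (split_ordP i) => i' ->; case: (split_ordP j) => j' ->;
    rewrite ?block_mxEul ?block_mxEur ?block_mxEdl ?block_mxEdr !mxE /=
      ?ltn_ord ?ord1 ?addn0 ?ltnn.
have rE : r = q *m W.
  by apply/rowP => j; rewrite !mxE hm//; apply: eq_bigr => i _; rewrite !mxE.
pose L : 'M[C]_(m + 1) := block_mx 1%:M 0 (- q) 1%:M.
have detL : \det L = 1 by rewrite /L det_lblock !det1 mulr1.
rewrite -[LHS]mul1r -detL -det_mulmx mulmx_block !mul1mx !mul0mx !addr0.
rewrite mulNmx rE addNr det_ublock; congr (_ * _).
rewrite [X in \det X]mx11_scalar det_scalar1 !mxE addrC; congr (_ + _).
by rewrite -sumrN; apply: eq_bigr => i _; rewrite !mxE mulNr.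
Qed.

Lemma wronskianS m h x :
  wronskian m.+1 h x = wronskian m.+1 (append m h (h m)) x.
Proof.
congr (\det _); apply/matrixP => i j; rewrite !mxE /append.
by have [//|mj] := ltnP; rewrite (@anti_leq j m)// mj -ltnS ltn_ord.
Qed.

(** One component of [darboux_iter]: the two components of a couple are
    transformed independently of each other. *)
Fixpoint darboux1 h m f : R -> C :=
  if m is m'.+1 then
    fun x => cderiv (darboux1 h m' f) x -
      cderiv (darboux1 h m' (h m')) x / darboux1 h m' (h m') x *
      darboux1 h m' f x
  else f.

Lemma darboux_iterE (c : nat -> couple R) m (p : couple R) :
  darboux_iter c m p = (darboux1 (fun j => (c j).1) m p.1,
                        darboux1 (fun j => (c j).2) m p.2).
Proof.
elim: m p => [|m IH] p; first by case: p.
by rewrite /= !IH.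
Qed.

(** The first [m] transformations are defined everywhere on [U]. *)
Definition darboux1_regular U h m : Prop :=
  forall j x, (j < m)%N -> U x -> darboux1 h j (h j) x != 0.

Lemma darboux1_regularW U h m : darboux1_regular U h m.+1 ->
  darboux1_regular U h m.
Proof. by move=> hU j x jm; apply: hU; rewrite ltnS ltnW. Qed.

Lemma darboux1_upto U N h m f : open U -> (m <= N)%N ->
  (forall j, (j < m)%N -> cderivable_upto U N (h j)) ->
  darboux1_regular U h m -> cderivable_upto U N f ->
  cderivable_upto U (N - m) (darboux1 h m f).
Proof.
move=> oU; elim: m f => [|m IH] f mN hN hU fN; first by rewrite subn0.
have hN' j : (j < m)%N -> cderivable_upto U N (h j).
  by move=> jm; apply: hN; rewrite ltnS ltnW.
have hU' := darboux1_regularW hU.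
have gU := IH _ (ltnW mN) hN' hU' (hN m (ltnSn m)).
have {}fN := IH _ (ltnW mN) hN' hU' fN.
have NS : (N - m = (N - m.+1).+1)%N by rewrite subnSK.
rewrite NS in gU fN.
have lower g : cderivable_upto U (N - m.+1).+1 g ->
    cderivable_upto U (N - m.+1) (cderiv g).
  by move=> gN; apply: (@cderivable_upto_cderivn _ _ _ 1); rewrite addn1.
apply: (cderivable_uptoB oU (lower _ fN)).
apply: (cderivable_uptoM oU); last exact: cderivable_uptoW fN.
apply: (cderivable_uptoM oU (lower _ gU)).
apply: (cderivable_uptoV oU); last exact: cderivable_uptoW gU.
by move=> t Ut; exact: hU.
Qed.

(** The function by which one transforms is sent to zero, and the later
    transformations keep it zero. *)
Lemma darboux1_kernel U h m j x : open U -> darboux1_regular U h m ->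
  (j < m)%N -> U x -> darboux1 h m (h j) x = 0.
Proof.
move=> oU; elim: m x => // m IH x hU jm Ux /=.
have [jm'|] := ltnP j m; last first.
  move=> mj; have -> : j = m by apply: anti_leq; rewrite mj -ltnS jm.
  by rewrite divfK ?subrr //; exact: hU.
have E t : U t -> darboux1 h m (h j) t = 0.
  by move=> Ut; apply: IH => //; exact: darboux1_regularW.
rewrite (E x Ux) mulr0 subr0; apply: has_cderivE.
apply: (open_has_cderiv oU Ux _ (has_cderiv_cst 0 x)).
by move=> t /E.
Qed.

(** By induction, [m] transformations form a monic differential operator of
    order [m]: one more step composes it with [d/dx - rho], where
    [rho = g' / g] and [g] is [h m] transformed [m] times. The coefficients are
    extended by zero beyond [m], so that the recursion
    [p' + (shifted p) - rho p] has the same form at every index. *)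
Lemma darboux1_operator U N h m : open U -> (m <= N)%N ->
  (forall j, (j < m)%N -> cderivable_upto U N (h j)) ->
  darboux1_regular U h m ->
  exists p : nat -> R -> C,
   [/\ p m = (fun=> 1), forall i, (m < i)%N -> p i = (fun=> 0),
       forall i, cderivable_upto U (N - m) (p i) &
       forall f x, cderivable_upto U m f -> U x ->
         darboux1 h m f x = \sum_(i < m.+1) p i x * cderivn i f x].
Proof.
move=> oU; elim: m => [|m IH] mN hN hU.
  exists (fun i => if i is 0 then fun=> 1 else fun=> 0); split=> //.
  - by case.
  - by case=> [|i]; exact: cderivable_upto_cst.
  - by move=> f x _ _; rewrite big_ord1 mul1r.
have hN' j : (j < m)%N -> cderivable_upto U N (h j).
  by move=> jm; apply: hN; rewrite ltnS ltnW.
have hU' := darboux1_regularW hU.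
have [p [pm p0 pU pE]] := IH (ltnW mN) hN' hU'.
have gU := darboux1_upto oU (ltnW mN) hN' hU' (hN m (ltnSn m)).
have NS : (N - m = (N - m.+1).+1)%N by rewrite subnSK.
rewrite NS in gU pU.
have lower f : cderivable_upto U (N - m.+1).+1 f ->
    cderivable_upto U (N - m.+1) (cderiv f).
  by move=> fU; apply: (@cderivable_upto_cderivn _ _ _ 1); rewrite addn1.
pose g := darboux1 h m (h m); pose rho t := cderiv g t / g t.
have rhoU : cderivable_upto U (N - m.+1) rho.
  apply: (cderivable_uptoM oU (lower _ gU)).
  apply: (cderivable_uptoV oU); last exact: cderivable_uptoW gU.
  by move=> t Ut; exact: hU.
pose sh i : R -> C := if i is i'.+1 then p i' else fun=> 0.
exists (fun i t => cderiv (p i) t + sh i t - rho t * p i t); split.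
- apply/funext => t; rewrite /sh pm p0//.
  by rewrite (has_cderivE (has_cderiv_cst 0 t)) add0r mulr0 subr0.
- move=> [//|i] mi; apply/funext => t; rewrite /sh !p0//; last exact: ltnW.
  by rewrite (has_cderivE (has_cderiv_cst 0 t)) add0r mulr0 subr0.
- move=> i; apply: (cderivable_uptoB oU).
    apply: (cderivable_uptoD oU (lower _ (pU i))).
    case: i => [|i]; first exact: cderivable_upto_cst.
    exact: cderivable_uptoW (pU i).
  by apply: (cderivable_uptoM oU rhoU); exact: cderivable_uptoW (pU i).
move=> f x fU Ux /=; rewrite -/g.
have fm := cderivable_uptoW (leqnSn m) fU.
have dp (i : 'I_m.+1) : has_cderiv (p i) x (cderiv (p i) x).
  by apply: cderivableP; exact: (cderivable_uptoP (i := 0) (pU i)).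
have df (i : 'I_m.+1) : has_cderiv (cderivn i f) x (cderivn i.+1 f x).
  exact: (has_cderiv_cderivn fU).
have dsum : has_cderiv (darboux1 h m f) x
    (\sum_(i < m.+1) cderiv (p i) x * cderivn i f x +
     \sum_(i < m.+1) p i x * cderivn i.+1 f x).
  apply: (open_has_cderiv oU Ux _ (has_cderiv_sum_mul dp df)).
  by move=> t Ut; rewrite pE.
rewrite (has_cderivE dsum) -/(rho x) pE//.
have -> : \sum_(i < m.+2) (cderiv (p i) x + sh i x - rho x * p i x) *
      cderivn i f x =
    \sum_(i < m.+2) cderiv (p i) x * cderivn i f x +
    \sum_(i < m.+2) sh i x * cderivn i f x -
    rho x * \sum_(i < m.+2) p i x * cderivn i f x.
  rewrite -big_split mulr_sumr -sumrB; apply: eq_bigr => i _ /=.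
  by rewrite mulrBl mulrDl mulrA.
congr (_ + _ - _ * _).
- rewrite [RHS]big_ord_recr /= p0// (has_cderivE (has_cderiv_cst 0 x)).
  by rewrite mul0r addr0.
- by rewrite [RHS]big_ord_recl /= mul0r add0r; apply: eq_bigr => i _.
- by rewrite [RHS]big_ord_recr /= p0// mul0r addr0.
Qed.

(** Being defined at one point propagates to a neighbourhood by continuity;
    so that the derivatives taken along the way make sense. *)
Lemma darboux1_near I N h m x : open I -> I x -> (m <= N)%N ->
  (forall j, (j < m)%N -> cderivable_upto I N (h j)) ->
  (forall j, (j < m)%N -> darboux1 h j (h j) x != 0) ->
  exists U, [/\ open U, U `<=` I, U x & darboux1_regular U h m].
Proof.
move=> oI Ix; elim: m => [|m IH] mN hN hx; first by exists I; split.
have hN' j : (j < m)%N -> cderivable_upto I N (h j).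
  by move=> jm; apply: hN; rewrite ltnS ltnW.
have hx' j : (j < m)%N -> darboux1 h j (h j) x != 0.
  by move=> jm; apply: hx; rewrite ltnS ltnW.
have [U [oU UI Ux hU]] := IH (ltnW mN) hN' hx'.
pose g := darboux1 h m (h m).
have gU : cderivable_upto U (N - m) g.
  apply: (darboux1_upto oU (ltnW mN) _ hU).
    by move=> j jm; exact: cderivable_upto_sub UI (hN' j jm).
  exact: cderivable_upto_sub UI (hN m (ltnSn m)).
exists (U `&` [set t | g t != 0]); split.
- apply: open_setI_neq0 => // t Ut.
  by apply: (cderivable_uptoP (i := 0) gU) => //; rewrite subn_gt0.
- by move=> t [/UI].
- by split=> //; exact: hx.
- move=> j t; rewrite ltnS leq_eqVlt => /orP[/eqP-> [_ gt]//|jm [Ut _]].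
  exact: hU.
Qed.

(** The operator of [darboux1_operator] annihilates [h 0], ..., [h m.-1], so
    [wronskian_append] identifies it. *)
Lemma darboux1_wronskian I N h m f x : open I -> I x -> (m <= N)%N ->
  (forall j, (j < m)%N -> cderivable_upto I N (h j)) ->
  (forall j, (j < m)%N -> darboux1 h j (h j) x != 0) ->
  cderivable_upto I N f ->
  wronskian m.+1 (append m h f) x = wronskian m h x * darboux1 h m f x.
Proof.
move=> oI Ix mN hN hx fN.
have [U [oU UI Ux hU]] := darboux1_near oI Ix mN hN hx.
have hNU j : (j < m)%N -> cderivable_upto U N (h j).
  by move=> jm; exact: cderivable_upto_sub UI (hN j jm).
have [p [pm _ _ pE]] := darboux1_operator oU mN hNU hU.
have E g : cderivable_upto U N g -> darboux1 h m g x =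
    cderivn m g x - \sum_(i < m) - p i x * cderivn i g x.
  move=> gU; rewrite pE//; last exact: cderivable_uptoW gU.
  rewrite big_ord_recr /= pm mul1r addrC -sumrN; congr (_ + _).
  by apply: eq_bigr => i _; rewrite mulNr opprK.
rewrite E; last exact: cderivable_upto_sub UI fN.
apply: wronskian_append => j jm; apply/eqP; rewrite -subr_eq0 -E.
  by rewrite (darboux1_kernel oU hU jm Ux).
exact: hNU.
Qed.

Lemma wronskian_neq0 I N h m x : open I -> I x -> (m <= N)%N ->
  (forall j, (j < m)%N -> cderivable_upto I N (h j)) ->
  (forall j, (j < m)%N -> darboux1 h j (h j) x != 0) ->
  wronskian m h x != 0.
Proof.
move=> oI Ix; elim: m => [|m IH] mN hN hx.
  by rewrite /wronskian det_mx00 oner_neq0.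
have hN' j : (j < m)%N -> cderivable_upto I N (h j).
  by move=> jm; apply: hN; rewrite ltnS ltnW.
have hx' j : (j < m)%N -> darboux1 h j (h j) x != 0.
  by move=> jm; apply: hx; rewrite ltnS ltnW.
rewrite wronskianS (darboux1_wronskian oI Ix (ltnW mN) hN' hx' (hN m _))//.
by rewrite mulf_neq0 ?IH ?hx// ltnW.
Qed.

End Wronskian.

(** * Companion matrices and jets *)

Section Companion.
Variable R : realType.
Local Notation C := R[i].
Implicit Types (h : nat -> R -> C) (f g mu : R -> C) (U : set R) (x : R).
Implicit Types n : nat.

Definition wronskian_mx n h x := \matrix_(i < n, j < n) cderivn i (h j) x.

Definition jet n f x := \col_(i < n) cderivn i f x.

(** Multiplication by [mu], read on jets of length [n]. *)
Definition leibniz_mx n mu x := \matrix_(i < n, l < n) leibniz_coef mu i l x.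

(** With [jet1] below, the derivatives of the Wronskian matrix and of jets. *)
Definition wronskian_mx1 n h x := \matrix_(i < n, j < n) cderivn i.+1 (h j) x.

Definition jet1 n f x := \col_(i < n) cderivn i.+1 f x.

(** The matrix [C] with [A' = C A], for [A] the Wronskian matrix. It is the
    companion matrix of the monic operator of order [n] whose kernel is spanned
    by the family. *)
Definition companion n h x := wronskian_mx1 n h x *m invmx (wronskian_mx n h x).

Lemma has_mxderiv_wronskian_mx U n h x :
  (forall j, (j < n)%N -> cderivable_upto U n (h j)) -> U x ->
  has_mxderiv (wronskian_mx n h) x (wronskian_mx1 n h x).
Proof.
move=> hU Ux i j; rewrite mxE; under eq_fun do rewrite mxE.
exact: (has_cderiv_cderivn (hU j (ltn_ord j)) (ltn_ord i) Ux).
Qed.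

Lemma has_mxderiv_jet U n f x : cderivable_upto U n f -> U x ->
  has_mxderiv (jet n f) x (jet1 n f x).
Proof.
move=> fU Ux i j; rewrite mxE; under eq_fun do rewrite mxE.
exact: (has_cderiv_cderivn fU (ltn_ord i) Ux).
Qed.

Lemma wronskian_mx_unit n h x :
  (wronskian_mx n h x \in unitmx) = (wronskian n h x != 0).
Proof. by rewrite unitmxE unitfE. Qed.

Lemma companionK n h x : wronskian n h x != 0 ->
  companion n h x *m wronskian_mx n h x = wronskian_mx1 n h x.
Proof. by rewrite -wronskian_mx_unit => W0; rewrite /companion mulmxKV. Qed.

Lemma cderivable_wronskian U n h x :
  (forall j, (j < n)%N -> cderivable_upto U n (h j)) -> U x ->
  cderivable (wronskian n h) x.
Proof.
move=> hU Ux; apply: has_cderiv_cderivable.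
exact: (has_cderiv_det (has_mxderiv_wronskian_mx hU Ux)).
Qed.

(** Jacobi's formula: the logarithmic derivative of the Wronskian is the trace
    of the companion matrix. *)
Lemma has_cderiv_wronskian U n h x :
  (forall j, (j < n)%N -> cderivable_upto U n (h j)) -> U x ->
  wronskian n h x != 0 ->
  has_cderiv (wronskian n h) x (\tr (companion n h x) * wronskian n h x).
Proof.
move=> hU Ux W0.
apply: has_cderiv_eq (has_cderiv_det (has_mxderiv_wronskian_mx hU Ux)) _.
rewrite -(companionK W0) -mulmxA mul_mx_adj mul_mx_scalar linearZ.
exact: mulrC.
Qed.

Lemma has_mxderiv_companion U n h x :
  (forall j, (j < n)%N -> cderivable_upto U n.+1 (h j)) -> U x ->
  wronskian n h x != 0 ->
  exists C', has_mxderiv (companion n h) x C'.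
Proof.
move=> hU Ux; rewrite -wronskian_mx_unit => W0.
have hU' j : (j < n)%N -> cderivable_upto U n (h j).
  by move=> jn; apply: cderivable_uptoW (hU j jn).
have [V dV] := has_mxderiv_invmx (has_mxderiv_wronskian_mx hU' Ux) W0.
have d1 : has_mxderiv (wronskian_mx1 n h) x
    (\matrix_(i < n, j < n) cderivn i.+2 (h j) x).
  move=> i j; rewrite mxE; under eq_fun do rewrite mxE.
  exact: (has_cderiv_cderivn (i := i.+1) (hU j (ltn_ord j)) (ltn_ord i) Ux).
by eexists; exact: (has_mxderivM d1 dV).
Qed.

(** Row [i] of [A'] is row [i.+1] of [A]. *)
Lemma companion_row n h x (i : 'I_n.+1) j : wronskian n.+1 h x != 0 ->
  i != ord_max -> companion n.+1 h x i j = (i.+1 == j)%:R.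
Proof.
rewrite -wronskian_mx_unit => W0 im.
have im' : (i.+1 < n.+1)%N.
  by rewrite ltnS ltn_neqAle -ltnS ltn_ord andbT.
have E : row i (wronskian_mx1 n.+1 h x) =
    row (Ordinal im') (wronskian_mx n.+1 h x).
  by apply/rowP => l; rewrite !mxE.
have -> : companion n.+1 h x i j = (row i (companion n.+1 h x)) 0 j.
  by rewrite [RHS]mxE.
by rewrite /companion row_mul E -row_mul mulmxV// !mxE.
Qed.

#[local] Opaque companion.

(** The covariant derivative of the jet of [f] is concentrated on the last
    coordinate, where it is the quotient of Wronskians: the last row of the
    companion matrix carries the coefficients to which [wronskian_append]
    applies. *)
Lemma jet1E n h f x : wronskian n.+1 h x != 0 ->
  jet1 n.+1 f x = companion n.+1 h x *m jet n.+1 f x +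
    (wronskian n.+2 (append n.+1 h f) x / wronskian n.+1 h x) *:
    delta_mx ord_max 0.
Proof.
move=> W0; apply/colP => i; rewrite !mxE eqxx andbT.
have [->|im] := eqVneq i ord_max; last first.
  rewrite mulr0 addr0.
  have im' : (i.+1 < n.+1)%N by rewrite ltnS ltn_neqAle -ltnS ltn_ord andbT.
  rewrite (bigD1 (Ordinal im'))//= big1 => [|j ji]; rewrite companion_row//.
    by rewrite mxE eqxx mul1r addr0.
  by move: ji; rewrite -val_eqE eq_sym => /negPf ->; rewrite mul0r.
rewrite mulr1 (wronskian_append _ (c := companion n.+1 h x ord_max)).
  rewrite mulrAC divff// mul1r.
  under eq_bigr => j _ do rewrite [jet _ _ _ _ _]mxE.
  by rewrite addrC subrK.
move=> j jn; have /matrixP/(_ ord_max (Ordinal jn)) := companionK W0.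
rewrite [LHS]mxE [RHS]mxE /= => <-.
by apply: eq_bigr => l _; rewrite [wronskian_mx _ _ _ _ _]mxE.
Qed.

Lemma leibniz_mx_last n mu x (i : 'I_n.+1) : i != ord_max ->
  leibniz_mx n.+1 mu x i ord_max = 0.
Proof.
move=> im; rewrite mxE /leibniz_coef bin_small ?mul0r//=.
by rewrite ltn_neqAle -ltnS ltn_ord andbT.
Qed.

Lemma leibniz_mx_diag n mu x (i : 'I_n) : leibniz_mx n mu x i i = mu x.
Proof. by rewrite mxE /leibniz_coef binn subnn mul1r. Qed.

Lemma has_mxderiv_leibniz_mx U n mu x : cderivable_upto U n mu -> U x ->
  exists M', has_mxderiv (leibniz_mx n mu) x M'.
Proof.
move=> muU Ux.
exists (\matrix_(i, l) ('C(i, l)%:R * cderivn (i - l).+1 mu x)) => i l.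
rewrite mxE; under eq_fun do rewrite mxE; apply: has_cderivZ.
apply: (has_cderiv_cderivn muU _ Ux).
exact: leq_ltn_trans (leq_subr _ _) (ltn_ord i).
Qed.

Lemma cderivnD U i f g k x : open U -> cderivable_upto U i f ->
  cderivable_upto U i g -> U x ->
  cderivn i (fun t => f t + k * g t) x = cderivn i f x + k * cderivn i g x.
Proof.
move=> oU; elim: i x => [//|i IH] x fU gU Ux.
rewrite cderivnS; apply: has_cderivE.
apply: (open_has_cderiv oU Ux _ (has_cderivD (has_cderiv_cderivn fU _ Ux)
  (has_cderivZ k (has_cderiv_cderivn gU _ Ux)))) => //.
by move=> t Ut; rewrite IH//; exact: cderivable_uptoW (leqnSn i) _.
Qed.

(** The first order equation, differentiated up to [n - 1] times, in matrix
    form. *)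
Lemma jet_first_order U n mu f g k x : open U -> U x ->
  cderivable_upto U n mu -> cderivable_upto U n f -> cderivable_upto U n g ->
  (forall t, U t -> cderiv f t - mu t * f t = k * g t) ->
  jet1 n f x - leibniz_mx n mu x *m jet n f x = k *: jet n g x.
Proof.
move=> oU Ux muU fU gU fE; apply/colP => i; rewrite !mxE.
have fi := cderivable_uptoW (ltnW (ltn_ord i)) fU.
have gi := cderivable_uptoW (ltnW (ltn_ord i)) gU.
have mui := cderivable_uptoW (ltnW (ltn_ord i)) muU.
have -> : cderivn i.+1 f x = cderivn i (fun t => mu t * f t + k * g t) x.
  rewrite -addn1 -cderivn_add; apply: (eq_cderivn _ oU) => // t Ut.
  by rewrite -(fE t Ut) addrC subrK.
rewrite (cderivnD _ oU (cderivable_uptoM oU mui fi) gi Ux).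
rewrite (cderivn_mul oU mui fi (ltn_ord i) Ux).
by under [X in _ - X]eq_bigr => l _ do rewrite !mxE; rewrite addrAC subrr add0r.
Qed.

End Companion.

(* From here on, companion matrices are handled through the lemmas above. *)
#[local] Opaque companion.

(** * Transformed equation and trace identity *)

Lemma mxBE (F : comNzRingType) m n (K L : 'M[F]_(m, n)) i j :
  (K - L) i j = K i j - L i j.
Proof. by rewrite mxE [X in _ + X]mxE. Qed.

Lemma mxtraceB (F : comNzRingType) n (K L : 'M[F]_n) :
  \tr (K - L) = \tr K - \tr L.
Proof. by rewrite -sumrB; apply: eq_bigr => i _; exact: mxBE. Qed.

(** Adding the traces of the two intertwining relations, the derivatives of
    the multiplication matrices cancel and the products combine. *)
Lemma mxtrace_intertwining (F : comNzRingType) n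
    (P Q G H P' Q' M' N' : 'M[F]_n) :
  P' - M' + G *m P = Q *m G -> Q' - N' + H *m Q = P *m H ->
  \tr M' + \tr N' = 0 -> \tr P' + \tr Q' = \tr ((P - Q) *m (H - G)).
Proof.
move=> /(congr1 mxtrace) hG /(congr1 mxtrace) hH MN.
rewrite mulmxBl !mulmxBr !mxtraceB -hG -hH.
rewrite (mxtraceD (P' - M')) (mxtraceD (Q' - N')) !mxtraceB.
rewrite (mxtrace_mulC G) (mxtrace_mulC H) -[LHS]subr0 -MN.
ring.
Qed.

Section SeedFamilies.
Variable R : realType.
Local Notation C := R[i].
Implicit Types (U : set R) (n : nat) (mu a b : R -> C).
Implicit Types (alpha beta : nat -> R -> C) (kappa : nat -> C) (x t : R).

(** The hypotheses on the seed solutions, on an open set where both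
    Wronskians are nonzero and [mu] is as regular as the seeds make it. *)
Record seed_families U n mu alpha beta kappa : Prop := SeedFamilies {
  seed_open : open U;
  seed_mu : cderivable_upto U n mu;
  seed_alpha : forall j, (j < n)%N -> cderivable_upto U n.+1 (alpha j);
  seed_beta : forall j, (j < n)%N -> cderivable_upto U n.+1 (beta j);
  seed_alpha_eq : forall j, (j < n)%N -> forall t, U t ->
    cderiv (alpha j) t - mu t * alpha j t = kappa j * beta j t;
  seed_beta_eq : forall j, (j < n)%N -> forall t, U t ->
    cderiv (beta j) t + mu t * beta j t = kappa j * alpha j t;
  seed_alpha_neq0 : forall t, U t -> wronskian n alpha t != 0;
  seed_beta_neq0 : forall t, U t -> wronskian n beta t != 0
}.

(** Exchanging the two families changes the sign of [mu]; every statement on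
    the first component thus yields its counterpart for the second. *)
Lemma seed_families_sym U n mu alpha beta kappa :
  seed_families U n mu alpha beta kappa ->
  seed_families U n (fun t => - mu t) beta alpha kappa.
Proof.
case=> oU muU aU bU aE bE a0 b0.
apply: (SeedFamilies oU _ bU aU _ _ b0 a0).
- under eq_fun do rewrite -mulN1r; exact: (cderivable_uptoZ _ oU muU).
- by move=> j jn t Ut; rewrite mulNr opprK; exact: bE.
- by move=> j jn t Ut; rewrite mulNr; exact: aE.
Qed.

(** With [P] the companion matrix and [M] the multiplication matrix, this is
    the matrix [G] such that [d/dx - M = (d/dx - P) + G]. *)
Definition first_order_mx n mu alpha t :=
  companion n alpha t - leibniz_mx n mu t.

(** Column by column, these are the equations of the seeds differentiated up to
    [n - 1] times. *)
Lemma first_order_mx_wronskian U n mu alpha beta kappa t :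
  seed_families U n mu alpha beta kappa -> U t ->
  first_order_mx n mu alpha t *m wronskian_mx n alpha t =
  wronskian_mx n beta t *m diag_mx (\row_(j < n) kappa j).
Proof.
move=> S Ut; rewrite mulmxBl companionK; last exact: seed_alpha_neq0 S t Ut.
rewrite mul_mx_diag; apply/matrixP => i j.
have aU := cderivable_uptoW (leqnSn n) (seed_alpha S (ltn_ord j)).
have bU := cderivable_uptoW (leqnSn n) (seed_beta S (ltn_ord j)).
have /matrixP/(_ i 0) := jet_first_order (seed_open S) Ut (seed_mu S) aU bU
  (seed_alpha_eq S (ltn_ord j)).
rewrite !mxE mulrC => <-; congr (_ - _).
by apply: eq_bigr => l _; rewrite !mxE.
Qed.

Lemma seed_near (Q : R -> Prop) U n mu alpha beta kappa x :
  seed_families U n mu alpha beta kappa -> U x ->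
  (forall t, U t -> Q t) -> \forall t \near x, Q t.
Proof.
move=> S Ux UQ.
by apply: filterS (open_nbhs_nbhs (conj (seed_open S) Ux)).
Qed.

Lemma seed_dalpha U n mu alpha beta kappa x :
  seed_families U n mu alpha beta kappa -> U x ->
  has_mxderiv (wronskian_mx n alpha) x
    (companion n alpha x *m wronskian_mx n alpha x).
Proof.
move=> S Ux; rewrite companionK; last exact: seed_alpha_neq0 S x Ux.
apply: has_mxderiv_wronskian_mx Ux => j jn.
exact: cderivable_uptoW (leqnSn n) (seed_alpha S jn).
Qed.

Lemma seed_derivatives U n mu alpha beta kappa x :
  seed_families U n mu alpha beta kappa -> U x ->
  exists P' M', [/\ has_mxderiv (companion n alpha) x P',
    has_mxderiv (leibniz_mx n mu) x M' &
    has_mxderiv (first_order_mx n mu alpha) x (P' - M')].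
Proof.
move=> S Ux.
have [P' dP] := has_mxderiv_companion (seed_alpha S) Ux
  (seed_alpha_neq0 S Ux).
have [M' dM] := has_mxderiv_leibniz_mx (seed_mu S) Ux.
by exists P', M'; split=> //; exact: has_mxderivB.
Qed.

Lemma companion_diff_row n alpha beta x (i j : 'I_n.+1) :
  wronskian n.+1 alpha x != 0 -> wronskian n.+1 beta x != 0 ->
  i != ord_max ->
  (companion n.+1 alpha x - companion n.+1 beta x) i j = 0.
Proof. by move=> a0 b0 im; rewrite mxBE !companion_row// subrr. Qed.

Lemma mxtrace_companion_diff n alpha beta x :
  wronskian n.+1 alpha x != 0 -> wronskian n.+1 beta x != 0 ->
  companion n.+1 alpha x ord_max ord_max -
    companion n.+1 beta x ord_max ord_max =
  \tr (companion n.+1 alpha x) - \tr (companion n.+1 beta x).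
Proof.
move=> a0 b0; rewrite -mxtraceB /mxtrace (bigD1 ord_max)//= big1.
  by rewrite addr0 mxBE.
by move=> i im; rewrite companion_diff_row.
Qed.

(** The jets of [a] and [b] satisfy [G v + a_n e = k w] with [v' = P v + a_n e]
    and [w' = Q w + b_n e]. The last coordinate of [intertwining_defect] is the
    transformed equation, because [P - Q] has the difference of the traces as
    last diagonal entry and the multiplication matrix has [mu]. *)
Lemma seed_equation U n mu alpha beta kappa a b k x :
  seed_families U n.+1 mu alpha beta kappa -> U x ->
  cderivable_upto U n.+2 a -> cderivable_upto U n.+2 b ->
  (forall t, U t -> cderiv a t - mu t * a t = k * b t) ->
  let a_n t :=
    wronskian n.+2 (append n.+1 alpha a) t / wronskian n.+1 alpha t in
  let b_n t :=
    wronskian n.+2 (append n.+1 beta b) t / wronskian n.+1 beta t in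
  cderiv a_n x - (mu x - (\tr (companion n.+1 alpha x) -
    \tr (companion n.+1 beta x))) * a_n x = k * b_n x.
Proof.
move=> S Ux aU bU abE a_n b_n; have oU := seed_open S.
have a0 := seed_alpha_neq0 S; have b0 := seed_beta_neq0 S.
have [P' [M' [dP dM dG]]] := seed_derivatives S Ux.
have aU1 := cderivable_uptoW (leqnSn _) aU.
have bU1 := cderivable_uptoW (leqnSn _) bU.
have da : cderivable a_n x.
  apply: has_cderiv_cderivable; apply: has_cderivM.
    apply: cderivableP; apply: cderivable_wronskian Ux => j jn.
    by rewrite /append; case: ltnP => [jn'|_]; [exact: seed_alpha S j jn'|].
  apply: has_cderivV; first exact: a0.
  apply: cderivableP; apply: cderivable_wronskian Ux => j jn.
  exact: cderivable_uptoW (leqnSn _) (seed_alpha S jn).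
have dja : has_mxderiv (jet n.+1 a) x
    (companion n.+1 alpha x *m jet n.+1 a x + a_n x *: delta_mx ord_max 0).
  by rewrite -jet1E ?a0//; exact: has_mxderiv_jet aU1 Ux.
have djb : has_mxderiv (jet n.+1 b) x
    (companion n.+1 beta x *m jet n.+1 b x + b_n x *: delta_mx ord_max 0).
  by rewrite -jet1E ?b0//; exact: has_mxderiv_jet bU1 Ux.
have Gv : \forall t \near x, first_order_mx n.+1 mu alpha t *m jet n.+1 a t +
    a_n t *: delta_mx ord_max 0 = k *: jet n.+1 b t.
  apply: (seed_near S Ux) => t Ut; rewrite mulmxBl addrAC -jet1E ?a0//.
  exact: (jet_first_order oU Ut (seed_mu S) aU1 bU1 abE).
have GA : \forall t \near x,
    first_order_mx n.+1 mu alpha t *m wronskian_mx n.+1 alpha t =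
    wronskian_mx n.+1 beta t *m diag_mx (\row_(j < n.+1) kappa j).
  by apply: (seed_near S Ux) => t Ut; exact: first_order_mx_wronskian S Ut.
have uA : wronskian_mx n.+1 alpha x \in unitmx.
  by rewrite wronskian_mx_unit a0.
have := intertwining_defect uA (seed_dalpha S Ux)
  (seed_dalpha (seed_families_sym S) Ux) dG GA dja djb (cderivableP da) Gv.
move=> /matrixP/(_ ord_max 0).
have eE : (delta_mx ord_max 0 : 'cV[C]_n.+1) ord_max 0 = 1.
  by rewrite mxE !eqxx.
have colE (X : 'M[C]_n.+1) :
    (X *m (delta_mx ord_max 0 : 'cV[C]_n.+1)) ord_max 0 = X ord_max ord_max.
  by rewrite -colE [LHS]mxE.
rewrite [LHS]mxE [RHS]mxE [X in X + _]mxE [X in _ + X]mxE colE eE !mulr1.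
rewrite !mxBE leibniz_mx_diag => ->.
rewrite -mxtrace_companion_diff ?a0 ?b0//.
ring.
Qed.

(** Write [P], [Q] for the two companion matrices and [d] for
    [\tr P - \tr Q]. The two intertwining relations, for [G] and for its mirror
    image [H], give [\tr P' + \tr Q' = \tr ((P - Q) (H - G))]. As [P - Q] lives
    on the last row, and the last column of [H - G] is [2 mu - d] times the last
    basis vector, this is [d (2 mu - d)]. *)
Lemma seed_trace U n mu alpha beta kappa x :
  seed_families U n.+1 mu alpha beta kappa -> U x ->
  exists u' v', [/\
    has_cderiv (fun t => \tr (companion n.+1 alpha t)) x u',
    has_cderiv (fun t => \tr (companion n.+1 beta t)) x v' &
    u' + v' =
      (\tr (companion n.+1 alpha x) - \tr (companion n.+1 beta x)) *
      (mu x *+ 2 -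
       (\tr (companion n.+1 alpha x) - \tr (companion n.+1 beta x)))].
Proof.
move=> S Ux; have S' := seed_families_sym S.
have a0 := seed_alpha_neq0 S Ux; have b0 := seed_beta_neq0 S Ux.
have [P' [M' [dP dM dG]]] := seed_derivatives S Ux.
have [Q' [N' [dQ dN dH]]] := seed_derivatives S' Ux.
exists (\tr P'), (\tr Q'); split; try exact: has_cderiv_mxtrace.
have trMN : \tr M' + \tr N' = 0.
  have := has_cderivD (has_cderiv_mxtrace dM) (has_cderiv_mxtrace dN).
  have -> : (fun t => \tr (leibniz_mx n.+1 mu t) +
      \tr (leibniz_mx n.+1 (fun t => - mu t) t)) = fun=> 0.
    apply/funext => t; rewrite /mxtrace -big_split big1//= => i _.
    by rewrite !leibniz_mx_diag subrr.
  by move/has_cderivE => <-; apply: has_cderivE; exact: has_cderiv_cst.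
have GA : \forall t \near x,
    first_order_mx n.+1 mu alpha t *m wronskian_mx n.+1 alpha t =
    wronskian_mx n.+1 beta t *m diag_mx (\row_(j < n.+1) kappa j).
  by apply: (seed_near S Ux) => t Ut; exact: first_order_mx_wronskian S Ut.
have HB : \forall t \near x,
    first_order_mx n.+1 (fun t => - mu t) beta t *m wronskian_mx n.+1 beta t =
    wronskian_mx n.+1 alpha t *m diag_mx (\row_(j < n.+1) kappa j).
  by apply: (seed_near S' Ux) => t Ut; exact: first_order_mx_wronskian S' Ut.
have uA : wronskian_mx n.+1 alpha x \in unitmx by rewrite wronskian_mx_unit.
have uB : wronskian_mx n.+1 beta x \in unitmx by rewrite wronskian_mx_unit.
have iA := intertwining uA (seed_dalpha S Ux) (seed_dalpha S' Ux) dG GA.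
have iB := intertwining uB (seed_dalpha S' Ux) (seed_dalpha S Ux) dH HB.
rewrite (mxtrace_intertwining iA iB trMN).
rewrite mxtrace_mul_last_row; first 1 last.
- by move=> i j im; exact: companion_diff_row.
- move=> i im; rewrite !mxBE !leibniz_mx_last//.
  by rewrite !companion_row// !subrr.
rewrite mxtraceB !mxBE !leibniz_mx_diag -mxtrace_companion_diff//.
by congr (_ * _); ring.
Qed.

End SeedFamilies.

(** * Local regularity and the tau function *)

Section Seeds.
Variable R : realType.
Local Notation C := R[i].
Implicit Types (U I : set R) (n : nat) (mu f g tau : R -> C).
Implicit Types (h alpha beta : nat -> R -> C) (kappa : nat -> C) (x t : R).

Lemma wronskian0 h : wronskian 0 h = fun=> 1.
Proof. by apply/funext => t; rewrite /wronskian det_mx00. Qed.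

Lemma wronskian1 h : wronskian 1 h = h 0.
Proof. by apply/funext => t; rewrite /wronskian det_mx11 mxE. Qed.

Lemma wronskian_neq0_ex n h x : wronskian n.+1 h x != 0 ->
  exists2 j, (j < n.+1)%N & h j x != 0.
Proof.
have [/existsP[j hj] _|h0] := boolP [exists j : 'I_n.+1, h j x != 0].
  by exists j.
rewrite /wronskian (expand_det_row _ ord0) big1 ?eqxx// => j _.
rewrite mxE /=; move: h0; rewrite negb_exists => /forallP/(_ j).
by rewrite negbK => /eqP ->; rewrite mul0r.
Qed.

(** A nonzero Wronskian forces some [alpha j] to be nonzero at [x]; near [x],
    [mu = (alpha j' - kappa j beta j) / alpha j] is then [n.+1] times
    differentiable. The regularity of [mu] comes from there. *)
Lemma seed_families_near I n mu alpha beta kappa x : open I -> I x ->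
  (forall j, (j < n.+1)%N -> cderivable_upto I n.+2 (alpha j)) ->
  (forall j, (j < n.+1)%N -> cderivable_upto I n.+2 (beta j)) ->
  (forall j, (j < n.+1)%N -> forall t, I t ->
    cderiv (alpha j) t - mu t * alpha j t = kappa j * beta j t) ->
  (forall j, (j < n.+1)%N -> forall t, I t ->
    cderiv (beta j) t + mu t * beta j t = kappa j * alpha j t) ->
  wronskian n.+1 alpha x != 0 -> wronskian n.+1 beta x != 0 ->
  exists U, [/\ U `<=` I, U x & seed_families U n.+1 mu alpha beta kappa].
Proof.
move=> oI Ix aI bI aE bE a0 b0.
have [j jn aj] := wronskian_neq0_ex a0.
have dW h : (forall j, (j < n.+1)%N -> cderivable_upto I n.+2 (h j)) ->
    forall t, I t -> cderivable (wronskian n.+1 h) t.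
  move=> hI t It; apply: cderivable_wronskian It => i iN.
  exact: cderivable_uptoW (leqnSn _) (hI i iN).
pose V := I `&` [set t | wronskian n.+1 alpha t != 0].
have oV : open V by apply: open_setI_neq0 oI (dW _ aI).
pose V' := V `&` [set t | wronskian n.+1 beta t != 0].
have oV' : open V'.
  by apply: open_setI_neq0 oV _ => t [It _]; exact: dW bI t It.
pose U := V' `&` [set t | alpha j t != 0].
have oU : open U.
  apply: open_setI_neq0 oV' _ => t [[It _] _].
  exact: (cderivable_uptoP (i := 0) (aI j jn) _ It).
have UI : U `<=` I by move=> t [[[]]].
have aU i : (i < n.+1)%N -> cderivable_upto U n.+2 (alpha i).
  by move=> iN; exact: cderivable_upto_sub UI (aI i iN).
have bU i : (i < n.+1)%N -> cderivable_upto U n.+2 (beta i).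
  by move=> iN; exact: cderivable_upto_sub UI (bI i iN).
have aj0 t : U t -> alpha j t != 0 by case.
have Ux : U x by [].
exists U; split; [exact: UI | exact: Ux |].
apply: (SeedFamilies oU _ aU bU) => [|i iN t /UI|i iN t /UI|t|t].
- apply: (@eq_cderivable_upto _ U _ (fun t =>
    (cderiv (alpha j) t - kappa j * beta j t) * (alpha j t)^-1) _ oU).
    move=> t Ut; rewrite -(aE j jn t (UI t Ut)) opprB addrC subrK mulfK//.
    exact: aj0.
  apply: (cderivable_uptoM oU).
    apply: (cderivable_uptoB oU).
      by apply: (@cderivable_upto_cderivn _ _ _ 1); rewrite addn1; exact: aU.
    apply: (cderivable_uptoZ _ oU).
    exact: cderivable_uptoW (leqnSn _) (bU j jn).
  apply: (cderivable_uptoV oU aj0).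
  exact: cderivable_uptoW (leqnSn _) (aU j jn).
- exact: aE.
- exact: bE.
- by case=> [[[_ ?] _] _].
- by case=> [[_ ?] _].
Qed.

Lemma dlogE f x k : f x != 0 -> has_cderiv f x (k * f x) -> dlog f x = k.
Proof. by move=> f0 df; rewrite /dlog (has_cderivE df) mulfK. Qed.

Lemma has_cderiv_dlogM f g x k l : has_cderiv f x (k * f x) ->
  has_cderiv g x (l * g x) ->
  has_cderiv (fun t => f t * g t) x ((k + l) * (f x * g x)).
Proof.
move=> df dg; apply: has_cderiv_eq (has_cderivM df dg) _; ring.
Qed.

Lemma has_cderiv_dlogV f x k : f x != 0 -> has_cderiv f x (k * f x) ->
  has_cderiv (fun t => (f t)^-1) x (- k * (f x)^-1).
Proof.
move=> f0 df; apply: has_cderiv_eq (has_cderivV f0 df) _.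
by field.
Qed.

Lemma has_cderiv_dlog f x : cderivable f x -> f x != 0 ->
  has_cderiv f x (dlog f x * f x).
Proof.
by move=> df f0; rewrite /dlog (divfK f0); exact: cderivableP.
Qed.

Lemma seed_dlog U n mu alpha beta kappa t :
  seed_families U n mu alpha beta kappa -> U t ->
  has_cderiv (wronskian n alpha) t
    (\tr (companion n alpha t) * wronskian n alpha t).
Proof.
move=> S Ut; apply: (has_cderiv_wronskian _ Ut (seed_alpha_neq0 S Ut)).
move=> j jn; exact: cderivable_uptoW (leqnSn _) (seed_alpha S jn).
Qed.

Lemma seed_dlog_ratio U n mu alpha beta kappa t :
  seed_families U n mu alpha beta kappa -> U t ->
  dlog (fun s => wronskian n alpha s / wronskian n beta s) t =
  \tr (companion n alpha t) - \tr (companion n beta t).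
Proof.
move=> S Ut; have S' := seed_families_sym S.
have a0 := seed_alpha_neq0 S Ut; have b0 := seed_alpha_neq0 S' Ut.
apply: dlogE; first by rewrite mulf_neq0 ?invr_eq0.
apply: has_cderiv_dlogM (seed_dlog S Ut) _.
exact: has_cderiv_dlogV b0 (seed_dlog S' Ut).
Qed.

(** Logarithmic derivatives turn the product into a sum of three terms, the
    last two of which are differentiated by [seed_trace]. *)
Lemma seed_tau U n mu alpha beta kappa tau x :
  seed_families U n.+1 mu alpha beta kappa -> U x ->
  cderivable_upto U 2 tau -> tau x != 0 ->
  let d := \tr (companion n.+1 alpha x) - \tr (companion n.+1 beta x) in
  cderiv (dlog (fun t =>
    tau t * (wronskian n.+1 alpha t * wronskian n.+1 beta t))) x =
  cderiv (dlog tau) x + d * (mu x *+ 2 - d).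
Proof.
move=> S Ux tauU tau0 d; have S' := seed_families_sym S.
have oU := seed_open S.
have dtau t : U t -> cderivable tau t.
  by move=> Ut; exact: (cderivable_uptoP (i := 0) tauU).
have [u' [v' [du dv <-]]] := seed_trace S Ux.
have ddtau : has_cderiv (dlog tau) x (cderiv (dlog tau) x).
  apply: cderivableP; apply: has_cderiv_cderivable.
  apply: has_cderivM (cderivableP (cderivable_uptoP (i := 1) tauU isT Ux)) _.
  exact: has_cderivV tau0 (cderivableP (dtau x Ux)).
apply: has_cderivE.
apply: near_has_cderiv (has_cderivD ddtau (has_cderivD du dv)).
have Unear := open_nbhs_nbhs (conj oU Ux).
have tnear := cderivable_near_neq0 (dtau x Ux) tau0.
apply: filterS2 Unear tnear => t Ut taut.
have a0 := seed_alpha_neq0 S Ut; have b0 := seed_alpha_neq0 S' Ut.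
apply/esym/dlogE; first by rewrite !mulf_neq0.
apply: has_cderiv_dlogM (has_cderiv_dlog (dtau t Ut) taut) _.
exact: has_cderiv_dlogM (seed_dlog S Ut) (seed_dlog S' Ut).
Qed.

End Seeds.

Theorem theorem6 (R : realType) (I : set R) (n : nat)
  (mu : R -> R[i]) (alpha beta : nat -> R -> R[i]) (kappa : nat -> R[i])
  (I_open : open I) (I_interval : is_interval I)
  (alpha_diff : forall j, (j < n)%N -> cderivable_upto I n.+1 (alpha j))
  (beta_diff : forall j, (j < n)%N -> cderivable_upto I n.+1 (beta j))
  (alpha_eq : forall j, (j < n)%N -> forall x, I x ->
     cderiv (alpha j) x - mu x * alpha j x = kappa j * beta j x)
  (beta_eq : forall j, (j < n)%N -> forall x, I x ->
     cderiv (beta j) x + mu x * beta j x = kappa j * alpha j x)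
  (alpha_indep : linearly_independent_on I n alpha)
  (beta_indep : linearly_independent_on I n beta) :
  let Wa := wronskian n alpha in
  let Wb := wronskian n beta in
  let mu_n : R -> R[i] := fun x => mu x - dlog (fun t => Wa t / Wb t) x in
  (forall (a b : R -> R[i]) (k : R[i]),
     cderivable_upto I n.+1 a -> cderivable_upto I n.+1 b ->
     (forall x, I x -> cderiv a x - mu x * a x = - k * b x) ->
     (forall x, I x -> cderiv b x + mu x * b x = k * a x) ->
     let a_n : R -> R[i] :=
       fun x => wronskian n.+1 (append n alpha a) x / Wa x in
     let b_n : R -> R[i] :=
       fun x => wronskian n.+1 (append n beta b) x / Wb x in
     let c : nat -> couple R := fun j => (alpha j, beta j) in
     (forall x, I x -> darboux_defined_at c n x ->
        a_n x = (darboux_iter c n (a, b)).1 x /\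
        b_n x = (darboux_iter c n (a, b)).2 x) /\
     (forall x, I x -> Wa x != 0 -> Wb x != 0 ->
        cderiv a_n x - mu_n x * a_n x = - k * b_n x /\
        cderiv b_n x + mu_n x * b_n x = k * a_n x)) /\
  (forall tau : R -> R[i],
     cderivable_upto I 2 tau ->
     (forall x, I x -> tau x != 0 -> mu x ^+ 2 = - cderiv (dlog tau) x) ->
     let tau_n : R -> R[i] := fun x => tau x * (Wa x * Wb x) in
     forall x, I x -> Wa x != 0 -> Wb x != 0 -> tau x != 0 ->
       mu_n x ^+ 2 = - cderiv (dlog tau_n) x).
Proof.
move=> Wa Wb mu_n; split.
  move=> a b k aI bI aE bE a_n b_n c; split.
    move=> x Ix cx.
    have ca j : (j < n)%N -> darboux1 alpha j (alpha j) x != 0.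
      by move=> /cx; rewrite darboux_iterE => -[].
    have cb j : (j < n)%N -> darboux1 beta j (beta j) x != 0.
      by move=> /cx; rewrite darboux_iterE => -[].
    rewrite darboux_iterE /a_n /b_n /Wa /Wb /=.
    rewrite (darboux1_wronskian I_open Ix (leqnSn n) alpha_diff ca aI).
    rewrite (darboux1_wronskian I_open Ix (leqnSn n) beta_diff cb bI).
    rewrite ![wronskian n _ x * _]mulrC !mulfK//.
    - exact: wronskian_neq0 I_open Ix (leqnSn n) beta_diff cb.
    - exact: wronskian_neq0 I_open Ix (leqnSn n) alpha_diff ca.
  move=> x Ix Wa0 Wb0; case: n => [|n] in alpha_diff beta_diff alpha_eq beta_eq
    alpha_indep beta_indep Wa Wb mu_n aI bI a_n b_n Wa0 Wb0 *.
    (* Without seeds [mu] need not be differentiable, but nothing is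
       transformed. *)
    have aE0 : a_n = a.
      by apply/funext => t; rewrite /a_n /Wa wronskian1 wronskian0 divr1.
    have bE0 : b_n = b.
      by apply/funext => t; rewrite /b_n /Wb wronskian1 wronskian0 divr1.
    have mE0 : mu_n x = mu x.
      rewrite /mu_n /Wa /Wb !wronskian0 /dlog.
      by rewrite (has_cderivE (has_cderiv_cst _ x)) mul0r subr0.
    by rewrite aE0 bE0 mE0 aE// bE.
  have [U [UI Ux S]] := seed_families_near I_open Ix alpha_diff beta_diff
    alpha_eq beta_eq Wa0 Wb0.
  have aU := cderivable_upto_sub UI aI; have bU := cderivable_upto_sub UI bI.
  rewrite /mu_n /Wa /Wb (seed_dlog_ratio S Ux); split.
    by apply: (seed_equation S Ux aU bU) => t /UI; exact: aE.
  have bE' t : U t -> cderiv b t - - mu t * b t = k * a t.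
    by move=> /UI Ut; rewrite mulNr opprK bE.
  (* The second equation is the first one for the exchanged families. *)
  have := seed_equation (seed_families_sym S) Ux bU aU bE'.
  rewrite -/Wa -/Wb -/a_n -/b_n => /= <-.
  by rewrite -mulNr; congr (_ + _ * _); rewrite opprB addrC; ring.
move=> tau tauI tauE tau_n x Ix Wa0 Wb0 tau0.
case: n => [|n] in alpha_diff beta_diff alpha_eq beta_eq
  alpha_indep beta_indep Wa Wb mu_n tau_n Wa0 Wb0 *.
  have tE0 : tau_n = tau.
    by apply/funext => t; rewrite /tau_n /Wa /Wb !wronskian0 !mulr1.
  have mE0 : mu_n x = mu x.
    rewrite /mu_n /Wa /Wb !wronskian0 /dlog.
    by rewrite (has_cderivE (has_cderiv_cst _ x)) mul0r subr0.
  by rewrite tE0 mE0; exact: tauE.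
have [U [UI Ux S]] := seed_families_near I_open Ix alpha_diff beta_diff
  alpha_eq beta_eq Wa0 Wb0.
rewrite (seed_tau S Ux (cderivable_upto_sub UI tauI) tau0).
rewrite /mu_n /Wa /Wb (seed_dlog_ratio S Ux) [RHS]opprD -tauE//.
ring.
Qed.
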